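(* The class of Hamiltonian systems is universal for all smooth vector fields. That is: for every smooth manifold $M$ and every smooth vector field $X$ on $M$, there exist a symplectic manifold $(N,\omega)$, a smooth function $H: N\to\mathbb{R}$ with associated Hamiltonian vector field $X_H$, and an embedding $\varphi: M\hookrightarrow N$ such that $\varphi_*(X) = X_H|_{\varphi(M)}$.
   Context: Smooth manifolds are Hausdorff, second countable and locally Euclidean with smooth changes of coordinates. A symplectic manifold is a manifold $N$ with a non-degenerate closed $2$-form $\omega\in\Omega^2(N)$; for a smooth $H:N\to\mathbb{R}$, the Hamiltonian vector field $X_H$ is the unique vector field with $\iota_{X_H}\omega = dH$. A Hamiltonian system is a pair $(N, X_H)$ of this kind. For an embedding $\varphi:M\hookrightarrow N$ and a vector field $X$ on $M$, $\varphi_*(X)$ is the vector field along the image defined by $\varphi_*(X)_{\varphi(p)} = (\varphi_* )_p(X_p)$, where $(\varphi_* )_p: T_pM\to T_{\varphi(p)}N$ is the differential. A class $\mathcal{U}=\{(N,Y)\}$ of manifolds with vector fields is universal for a class $\mathcal{C}=\{(M,X)\}$ if for every $(M,X)\in\mathcal{C}$ there exist $(N,Y)\in\mathcal{U}$ and an embedding $\varphi:M\hookrightarrow N$ with $\varphi_*(X)=Y|_{\varphi(M)}$. *)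

(* Defs.v *)
From mathcomp Require Import all_boot all_order all_algebra.
From mathcomp Require Import all_classical all_reals all_analysis.

Set Implicit Arguments.
Unset Strict Implicit.
Unset Printing Implicit Defensive.

Import Order.TTheory GRing.Theory Num.Theory.
Import numFieldNormedType.Exports.
Local Open Scope classical_set_scope.
Local Open Scope ring_scope.

(* [U] is meant to be open, so that continuity and differentiability at the
   points of [U] only depend on the restriction of [f] to [U]. *)
Fixpoint Ck_on (R : realType) (n : nat) (W : normedModType R) (k : nat)
    (U : set 'rV[R]_n) (f : 'rV[R]_n -> W) : Prop :=
  if k is k'.+1 then
    (forall x, U x -> differentiable f x) /\
    (forall v : 'rV[R]_n, Ck_on k' U ('D_v f))
  else forall x, U x -> {for x, continuous f}.

Definition smooth_on (R : realType) (n : nat) (W : normedModType R)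
    (U : set 'rV[R]_n) (f : 'rV[R]_n -> W) : Prop :=
  forall k, Ck_on k U f.

(* A homeomorphism from an open set [cdom] of [T] onto an open set [ccod] of
   R^n. Both [cmap] and its inverse [cinv] are total functions, whose values
   outside [cdom] and [ccod] are irrelevant. *)
Record chart (R : realType) (T : topologicalType) (n : nat) := Chart {
  cdom : set T;
  ccod : set 'rV[R]_n;
  cmap : T -> 'rV[R]_n;
  cinv : 'rV[R]_n -> T;
  cdom_open : open cdom;
  ccod_open : open ccod;
  cmap_fun : forall p, cdom p -> ccod (cmap p);
  cinv_fun : forall x, ccod x -> cdom (cinv x);
  cmapK : forall p, cdom p -> cinv (cmap p) = p;
  cinvK : forall x, ccod x -> cmap (cinv x) = x;
  cmap_continuous : forall p, cdom p -> {for p, continuous cmap};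
  cinv_continuous : forall x, ccod x -> {for x, continuous cinv} }.

(* An n-dimensional smooth manifold (possibly empty, possibly n = 0). The
   smooth structure is given by an atlas, which need not be maximal. A chart
   [chart_at p] around each point [p] is singled out: besides expressing that
   the charts cover the manifold, it provides a model of the tangent space at
   [p] (see [tangent_space]). *)
Record manifold (R : realType) (n : nat) := Manifold {
  carrier :> topologicalType;
  atlas : set (chart R carrier n);
  chart_at : carrier -> chart R carrier n;
  manifold_hausdorff : hausdorff_space carrier;
  manifold_second_countable : @second_countable carrier;
  chart_at_atlas : forall p, atlas (chart_at p);
  chart_at_dom : forall p, cdom (chart_at p) p;
  atlas_compatible : forall c d, atlas c -> atlas d ->
    smooth_on (ccod c `&` cinv c @^-1` cdom d) (cmap d \o cinv c) }.

(* A tangent vector at [p] is represented by its coordinates in the chart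
   [chart_at p]; [dchart c p] below gives its coordinates in another chart. *)
Definition tangent_space (R : realType) (n : nat) (M : manifold R n)
  (p : M) : Type := 'rV[R]_n.

(* The differential T_pM -> R^n at [p] of a chart [c] around [p]. *)
Definition dchart (R : realType) (n : nat) (M : manifold R n)
    (c : chart R M n) (p : M) (v : tangent_space p) : 'rV[R]_n :=
  'd (cmap c \o cinv (chart_at p)) (cmap (chart_at p) p) v.

(* The differential R^n -> T_(cinv c x)M at [x] of the parametrization
   [cinv c]. *)
Definition dparam (R : realType) (n : nat) (M : manifold R n)
    (c : chart R M n) (x v : 'rV[R]_n) : tangent_space (cinv c x) :=
  'd (cmap (chart_at (cinv c x)) \o cinv c) x v.

Definition smooth_fun (R : realType) (n : nat) (M : manifold R n)
    (H : M -> R) : Prop :=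
  forall c, atlas c -> smooth_on (ccod c) (H \o cinv c).

(* dH_p : T_pM -> R *)
Definition dfun (R : realType) (n : nat) (M : manifold R n)
    (H : M -> R) (p : M) (v : tangent_space p) : R :=
  'd (H \o cinv (chart_at p)) (cmap (chart_at p) p) v.

Definition smooth_map (R : realType) (m n : nat)
    (M : manifold R m) (N : manifold R n) (f : M -> N) : Prop :=
  continuous f /\
  forall c d, @atlas R m M c -> @atlas R n N d ->
    smooth_on (ccod c `&` (f \o cinv c) @^-1` cdom d)
              (cmap d \o f \o cinv c).

(* (f_* )_p : T_pM -> T_(f p)N *)
Definition differential (R : realType) (m n : nat)
    (M : manifold R m) (N : manifold R n) (f : M -> N) (p : M)
    (v : tangent_space p) : tangent_space (f p) :=
  'd (cmap (chart_at (f p)) \o f \o cinv (chart_at p))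
     (cmap (chart_at p) p) v.

(* A smooth immersion that is a homeomorphism onto its image, the latter with
   the topology induced by [N]. *)
Definition embedding (R : realType) (m n : nat)
    (M : manifold R m) (N : manifold R n) (f : M -> N) : Prop :=
  [/\ smooth_map f,
      forall p : M, injective (differential f (p := p)),
      injective f &
      forall U : set M, open U -> exists2 V : set N, open V & U = f @^-1` V].

Record vector_field (R : realType) (n : nat) (M : manifold R n) :=
  VectorField {
    vf_val :> forall p : M, tangent_space p;
    vf_smooth : forall c : chart R M n, atlas c ->
      smooth_on (ccod c) (fun x => dchart c (vf_val (cinv c x))) }.

(* The coefficient of [omega] in the chart [c], evaluated on the constant
   vector fields [u] and [v] of R^n. *)
Definition local_form (R : realType) (n : nat) (M : manifold R n)
    (omega : forall p : M, tangent_space p -> tangent_space p -> R)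
    (c : chart R M n) (u v x : 'rV[R]_n) : R :=
  omega (cinv c x) (dparam c x u) (dparam c x v).

Definition is_two_form (R : realType) (n : nat) (M : manifold R n)
    (omega : forall p : M, tangent_space p -> tangent_space p -> R) : Prop :=
  [/\ forall (p : M) (u : 'rV[R]_n), scalar (omega p u : 'rV[R]_n -> R),
      forall (p : M) (v : 'rV[R]_n), scalar (omega p ^~ v : 'rV[R]_n -> R),
      forall (p : M) (u : tangent_space p), omega p u u = 0 &
      forall (c : chart R M n) (u v : 'rV[R]_n), atlas c ->
        smooth_on (ccod c) (local_form omega c u v)].

Record two_form (R : realType) (n : nat) (M : manifold R n) := TwoForm {
  form_val :> forall p : M, tangent_space p -> tangent_space p -> R;
  form_valP : is_two_form form_val }.

(* d omega = 0: in a chart, (d omega)(u, v, w) is the cyclic sum below, where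
   u, v, w are constant vector fields of R^n (so that the bracket terms of the
   invariant formula for the exterior derivative vanish). *)
Definition closed_form (R : realType) (n : nat) (M : manifold R n)
    (omega : two_form M) : Prop :=
  forall (c : chart R M n) (x u v w : 'rV[R]_n), atlas c -> ccod c x ->
    'D_u (local_form omega c v w) x + 'D_v (local_form omega c w u) x
      + 'D_w (local_form omega c u v) x = 0.

Definition nondegenerate_form (R : realType) (n : nat) (M : manifold R n)
    (omega : two_form M) : Prop :=
  forall (p : M) (u : tangent_space p),
    (forall v : tangent_space p, omega p u v = 0) -> u = (0 : 'rV[R]_n).

Definition symplectic (R : realType) (n : nat) (M : manifold R n)
    (omega : two_form M) : Prop :=
  nondegenerate_form omega /\ closed_form omega.

(* iota_Y omega = dH. Such a [Y] is unique when [omega] is nondegenerate. *)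
Definition is_hamiltonian_field (R : realType) (n : nat) (M : manifold R n)
    (omega : two_form M) (H : M -> R) (Y : vector_field M) : Prop :=
  forall (p : M) (v : tangent_space p), omega p (Y p) v = dfun H v.

Definition dynamics_class (R : realType) :=
  forall (n : nat) (M : manifold R n), vector_field M -> Prop.

Definition universal_for (R : realType) (U C : dynamics_class R) : Prop :=
  forall (m : nat) (M : manifold R m) (X : vector_field M), C m M X ->
    exists (n : nat) (N : manifold R n) (Y : vector_field N),
      U n N Y /\
      exists f : M -> N, embedding f /\
        forall p : M, differential f (X p) = Y (f p).

Definition hamiltonian_systems (R : realType) : dynamics_class R :=
  fun n N Y => exists (omega : two_form N) (H : N -> R),
    [/\ symplectic omega, smooth_fun H & is_hamiltonian_field omega H Y].

(* [vector_field] is already restricted to smooth vector fields. *)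
Definition smooth_vector_fields (R : realType) : dynamics_class R :=
  fun n M X => True.

Arguments hamiltonian_systems R : clear implicits.
Arguments smooth_vector_fields R : clear implicits.

(* Main.v *)
Require Import Defs.
From mathcomp Require Import all_boot all_order all_algebra.
From mathcomp Require Import all_classical all_reals all_analysis.
From HB Require Import structures.
From mathcomp Require Import ring.

(* Take for N the cotangent bundle of M with its canonical symplectic form and
   H(p, xi) = xi(X_p). In canonical coordinates (x, xi), the field X_H is
   (X(x), - xi . DX(x)), whose vertical part vanishes for xi = 0: X_H extends
   the image of X under the zero section, which is an embedding. The canonical
   form has the same constant coefficients in all the charts lifted from M
   because second derivatives of transition maps are symmetric. *)

Set Implicit Arguments.
Unset Strict Implicit.
Unset Printing Implicit Defensive.

Import Order.TTheory GRing.Theory Num.Theory.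
Import numFieldNormedType.Exports.
Local Open Scope classical_set_scope.
Local Open Scope ring_scope.

(** The choice of [H] is forced up to its behaviour away from the zero section: with the form sum
    dx_j /\ dxi_j and the convention iota_Y omega = dH, the field is (dH/dxi, - dH/dx), so what is
    wanted along xi = 0 is dH/dxi = X and dH/dx = 0. The pairing xi(X) does this without any choice
    of coordinates.

    The obstacle is that tangent vectors and covectors at [p] are coordinates in [chart_at p], which
    may jump from point to point, so that nothing written in them is visibly smooth. The form, the
    Hamiltonian and its field are therefore defined pointwise in the distinguished chart, then shown
    to be given by the same formula in every lifted chart, where smoothness can be read off. For the
    form, this invariance is where second derivatives enter: the momentum part of a lifted
    transition contains a Jacobian, whose derivative must cancel. *)

Lemma open_near (T : topologicalType) (U : set T) (x : T) :
  open U -> U x -> \forall y \near x, U y.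
Proof. by move=> oU Ux; exact: open_nbhs_nbhs. Qed.

(** Both functions have the same first order expansion at [x], and the differential is unique. Since
    [cmap] and [cinv] are total with arbitrary values off their domains, identities between
    compositions of charts hold only near a point; this is how they are differentiated. *)
Lemma near_eq_diff (R : realType) (V W : normedModType R) (f g : V -> W) x :
  (\near x, f x = g x) -> differentiable f x ->
  differentiable g x /\ 'd g x = 'd f x :> (V -> W).
Proof.
move=> fg df.
have gE : g \o shift x = cst (g x) + 'd f x +o_ 0 id.
  apply/eqaddoP => _/posnumP[e].
  have /eqaddoP /(_ e%:num) /(_ [gt0 of e%:num]) := diff_locally df.
  have fg0 : \forall h \near 0, f (h + x) = g (h + x).
    by move: fg; rewrite (near_shift 0 x); apply: filterS => h; rewrite /= subr0.
  apply: filterS2 fg0 => h; rewrite !fctE /= => ->.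
  by rewrite (nbhs_singleton fg).
have dgE : 'd g x = 'd f x :> (V -> W).
  by apply: diff_unique gE; exact: diff_continuous.
split=> //; apply/diff_locallyP; split; first by rewrite dgE; exact: diff_continuous.
by rewrite dgE.
Qed.

(** * Functions of class C^k *)

Section Ck.
Variables (R : realType) (n : nat).
Implicit Types (W : normedModType R) (U : set 'rV[R]_n).

(** Openness of [U] turns equality on [U] into equality near each of its points, which directional
    derivatives respect, so the induction can go on. *)
Lemma Ck_on_ext W k U (f g : 'rV[R]_n -> W) : open U ->
  (forall x, U x -> f x = g x) -> Ck_on k U f -> Ck_on k U g.
Proof.
elim: k f g => [|k IH] f g oU fg /=.
  move=> cf x Ux; rewrite /prop_for /continuous_at -(fg _ Ux).
  have nfg : \forall y \near x, f y = g y.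
    by near=> y; apply: fg; near: y; exact: (open_near oU Ux).
  exact: cvg_trans (near_eq_cvg nfg) (cf _ Ux).
move=> [df cf]; have nfg x : U x -> \near x, f x = g x.
  by move=> Ux; near=> y; apply: fg; near: y; exact: (open_near oU Ux).
split=> [x Ux|v].
  by have [] := near_eq_diff (nfg _ Ux) (df _ Ux).
apply: IH (cf v) => // x Ux; exact: near_eq_derive (nfg _ Ux).
Unshelve. all: by end_near. Qed.

Lemma Ck_on_pred W k U (f : 'rV[R]_n -> W) : Ck_on k.+1 U f -> Ck_on k U f.
Proof.
elim: k f => [|k IH] f [df cf] /=.
  by move=> x Ux; exact/differentiable_continuous/df.
by split=> // v; apply: IH.
Qed.

Lemma Ck_on_cst W k U (w : W) : Ck_on k U (fun=> w).
Proof.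
elim: k w => [|k IH] w /=; first by move=> x _; exact: cst_continuous.
split=> [x _|v]; first exact: differentiable_cst.
have -> : 'D_v (fun=> w) = (fun=> 0) by apply/funext => x; rewrite derive_cst.
exact: IH.
Qed.

Lemma Ck_on_linear W k U (L : {linear 'rV[R]_n -> W}) :
  continuous L -> Ck_on k U L.
Proof.
move=> cL; case: k => [|k] /=; first by move=> x _; exact: cL.
have dL x : differentiable L x by exact: linear_differentiable.
split=> // v; have -> : 'D_v L = (fun=> L v).
  by apply/funext => x; rewrite deriveE// diff_lin.
exact: Ck_on_cst.
Qed.

Lemma Ck_on_linear_comp W W' k U (L : {linear W -> W'}) (f : 'rV[R]_n -> W) :
  open U -> continuous L -> Ck_on k U f -> Ck_on k U (L \o f).
Proof.
move=> oU cL; elim: k f => [|k IH] f /=.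
  by move=> cf x Ux; apply: continuous_comp; [exact: cf|exact: cL].
have dL x : differentiable L x by exact: linear_differentiable.
move=> [df cf]; split=> [x Ux|v].
  by apply: differentiable_comp; [exact: df|exact: dL].
apply: Ck_on_ext (IH _ (cf v)) => // x Ux /=.
rewrite !deriveE//; [|by apply: differentiable_comp; [exact: df|exact: dL] | exact: df].
by rewrite [in RHS]diff_comp//= ?diff_lin//; exact: df.
Qed.

Lemma Ck_onD W k U (f g : 'rV[R]_n -> W) : open U ->
  Ck_on k U f -> Ck_on k U g -> Ck_on k U (fun x => f x + g x).
Proof.
move=> oU; elim: k f g => [|k IH] f g /=.
  by move=> cf cg x Ux; apply: continuousD; [exact: cf|exact: cg].
move=> [df cf] [dg cg]; split=> [x Ux|v].
  by apply: differentiableD; [exact: df|exact: dg].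
apply: Ck_on_ext (IH _ _ (cf v) (cg v)) => // x Ux /=.
rewrite -(@deriveD _ _ _ f g)//; apply: diff_derivable; [exact: df|exact: dg].
Qed.

Lemma Ck_onM k U (f g : 'rV[R]_n -> R) : open U ->
  Ck_on k U f -> Ck_on k U g -> Ck_on k U (fun x => f x * g x).
Proof.
move=> oU; elim: k f g => [|k IH] f g.
  by move=> /= cf cg x Ux; apply: continuousM; [exact: cf|exact: cg].
move=> cf cg; have [/= df Df] := cf; have [/= dg Dg] := cg.
split=> [x Ux|v].
  by apply: differentiableM; [exact: df|exact: dg].
(* The Leibniz rule also involves [f] and [g] undifferentiated; they are used here with one order of
   regularity less. *)
apply: Ck_on_ext (Ck_onD oU (IH _ _ (Ck_on_pred cf) (Dg v))
  (IH _ _ (Ck_on_pred cg) (Df v))) => // x Ux /=.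
rewrite -(@deriveM _ _ f g)//; apply: diff_derivable; [exact: df|exact: dg].
Qed.

Lemma Ck_on_sum W k U (I : Type) (s : seq I) (f : I -> 'rV[R]_n -> W) :
  open U -> (forall i, Ck_on k U (f i)) ->
  Ck_on k U (fun x => \sum_(i <- s) f i x).
Proof.
move=> oU cf; elim: s => [|i s IH].
  by apply: Ck_on_ext (@Ck_on_cst _ k U 0) => // x _; rewrite big_nil.
by apply: Ck_on_ext (Ck_onD oU (cf i) IH) => // x _; rewrite big_cons.
Qed.

Lemma Ck_on_scalel W k U (f : 'rV[R]_n -> R) (w : W) : open U ->
  Ck_on k U f -> Ck_on k U (fun x => f x *: w).
Proof.
have sx_lin : linear ( *:%R ^~ w : R -> _).
  by move=> u y z; rewrite scalerDl scalerA.
pose sxlM := GRing.isLinear.Build _ _ _ _ _ sx_lin.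
pose sxL : {linear R -> W} := HB.pack (( *:%R ^~ w) : R -> W) sxlM.
move=> oU cf; apply: (@Ck_on_linear_comp _ _ _ _ sxL) => //.
exact: scalel_continuous.
Qed.

Lemma coord_is_linear m p (i : 'I_m) (j : 'I_p) :
  linear (fun A : 'M[R]_(m, p) => A i j : R).
Proof. by move=> a u v; rewrite !mxE. Qed.

Lemma Ck_on_coordP m k U (f : 'rV[R]_n -> 'rV[R]_m) : open U ->
  (forall j, Ck_on k U (fun x => f x 0 j : R)) <-> Ck_on k U f.
Proof.
move=> oU; split=> [cf|cf j]; last first.
  pose M := GRing.isLinear.Build _ _ _ _ _ (@coord_is_linear 1 m 0 j).
  pose L : {linear 'rV[R]_m -> R} := HB.pack (fun A : 'rV[R]_m => A 0 j : R) M.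
  by apply: (@Ck_on_linear_comp _ _ _ _ L) => //; exact: coord_continuous.
apply: (@Ck_on_ext _ _ _ (fun x => \sum_j f x 0 j *: delta_mx 0 j)) => //.
  by move=> x _; rewrite -row_sum_delta.
by apply: Ck_on_sum => // j; exact: Ck_on_scalel.
Qed.
End Ck.

Lemma diff_sum_delta (R : realType) n (W : normedModType R)
  (f : 'rV[R]_n -> W) x v :
  'd f x v = \sum_j v 0 j *: 'd f x (delta_mx 0 j).
Proof.
by rewrite {1}(row_sum_delta v) linear_sum; apply: eq_bigr => j _; rewrite linearZ.
Qed.

(** By the chain rule, the derivative of the composite along [v] is the sum over j of the j-th
    coordinate of ['D_v f] times the j-th partial derivative of [g] composed with [f]. The latter
    composite is again of the form treated, one order lower and with the same [f]; taking [g] scalar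
    keeps the products within [Ck_onM]. *)
Lemma Ck_on_comp_scalar (R : realType) m n k (U : set 'rV[R]_m)
  (V : set 'rV[R]_n) (f : 'rV[R]_m -> 'rV[R]_n) (g : 'rV[R]_n -> R) :
  open U -> (forall x, U x -> V (f x)) ->
  Ck_on k U f -> Ck_on k V g -> Ck_on k U (g \o f).
Proof.
move=> oU UV; elim: k f g UV => [|k IH] f g UV.
  move=> cf cg x Ux; apply: continuous_comp; first exact: cf.
  exact/cg/UV.
move=> cf cg; have [/= df Df] := cf; have [/= dg Dg] := cg.
split=> [x Ux|v].
  by apply: differentiable_comp; [exact: df|exact/dg/UV].
apply: (@Ck_on_ext _ _ _ _ _
  (fun x => \sum_j ('D_v f x) 0 j * 'D_(delta_mx 0 j) g (f x))) => //.
  move=> x Ux; have dgx := dg _ (UV _ Ux); have dfx := df _ Ux.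
  rewrite [RHS]deriveE; last exact: differentiable_comp.
  rewrite [in RHS]diff_comp//= [RHS]diff_sum_delta; apply: eq_bigr => j _.
  by rewrite !deriveE.
apply: Ck_on_sum => // j; apply: Ck_onM => //.
  by have /(Ck_on_coordP _ _ oU) := Df v; exact.
exact: (IH f _ UV (Ck_on_pred cf) (Dg _)).
Qed.

Lemma Ck_on_comp (R : realType) m n p k (U : set 'rV[R]_m)
  (V : set 'rV[R]_n) (f : 'rV[R]_m -> 'rV[R]_n) (g : 'rV[R]_n -> 'rV[R]_p) :
  open U -> open V -> (forall x, U x -> V (f x)) ->
  Ck_on k U f -> Ck_on k V g -> Ck_on k U (g \o f).
Proof.
move=> oU oV UV cf cg; apply/Ck_on_coordP => // j.
exact: (Ck_on_comp_scalar oU UV cf ((Ck_on_coordP _ _ oV).2 cg j)).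
Qed.

(** * Symmetry of second derivatives *)

Section Schwarz.
Variables (R : realType) (n : nat).
Implicit Types (f : 'rV[R]_n -> R) (x u v : 'rV[R]_n).

Lemma is_derive_line f x u (t : R) : differentiable f (x + t *: u) ->
  is_derive t 1 (fun s : R => f (x + s *: u)) ('D_u f (x + t *: u)).
Proof.
move=> dfx; have df : derivable f (x + t *: u) u by exact: diff_derivable.
have E : (fun h : R => h^-1 *: (((fun s : R => f (x + s *: u)) \o shift t) (h *: 1)
    - f (x + t *: u))) =
  (fun h => h^-1 *: ((f \o shift (x + t *: u)) (h *: u) - f (x + t *: u))).
  apply/funext => h /=; congr (_ *: (f _ - _)).
  by rewrite [_%:A]mulr1 scalerDl addrCA.
by apply: DeriveDef; rewrite /derivable /derive E.
Qed.

Lemma MVT_line f x u (h : R) : 0 < h ->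
  (forall t, 0 <= t <= h -> differentiable f (x + t *: u)) ->
  exists2 t, 0 < t < h & f (x + h *: u) - f x = 'D_u f (x + t *: u) * h.
Proof.
move=> h0 df.
have [t|c|c] := @MVT R (fun t => f (x + t *: u)) (fun t => 'D_u f (x + t *: u)) 0 h h0.
- rewrite in_itv/= => /andP[t0 th]; apply: is_derive_line.
  by apply: df; rewrite !ltW.
- apply: derivable_within_continuous => t; rewrite in_itv/= => t0h.
  by have [] := is_derive_line (df _ t0h).
- by rewrite in_itv/= => c0h; rewrite scale0r addr0 subr0 => E; exists c.
Qed.

(** The second difference of [f] over a parallelogram is the increment along [u] of
    [g y = f (y + h *: v) - f y]. The mean value theorem for [g] along [u], then for ['D_u f] along
    [v], turns it into a mixed derivative at an intermediate point. *)
Lemma MVT_square (U : set 'rV[R]_n) f x u v (h : R) :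
  Ck_on 2 U f -> 0 < h ->
  (forall s t, 0 <= s <= h -> 0 <= t <= h -> U (x + s *: u + t *: v)) ->
  exists s t, [/\ 0 < s < h, 0 < t < h &
    (f (x + h *: u + h *: v) - f (x + h *: u)) - (f (x + h *: v) - f x) =
    'D_v ('D_u f) (x + s *: u + t *: v) * h * h].
Proof.
move=> [df Df] h0 Uh; have h0h : 0 <= h <= h by rewrite (ltW h0) /=.
have h00 : 0 <= (0 : R) <= h by rewrite lexx (ltW h0).
have [Ddf _] := Df u.
pose g y := f (y + h *: v) - f y.
have dsh y : U (y + h *: v) -> differentiable (fun y => f (y + h *: v)) y.
  move=> Uy; apply: (@differentiable_comp _ _ _ _ (fun y => y + h *: v) f).
    by apply: differentiableD; [exact: ex_diff|exact: differentiable_cst].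
  exact: df.
have dg y : U y -> U (y + h *: v) -> differentiable g y.
  by move=> Uy Uyh; apply: differentiableB; [exact: dsh|exact: df].
have U1 s : 0 <= s <= h -> U (x + s *: u).
  by move=> sh; have := Uh _ _ sh h00; rewrite scale0r addr0.
have [s s0h E1] : exists2 s, 0 < s < h &
    g (x + h *: u) - g x = 'D_u g (x + s *: u) * h.
  apply: (@MVT_line g x u h h0) => t t0h; apply: dg; [exact: U1|exact: Uh].
have s0h' : 0 <= s <= h by case/andP: s0h => /ltW -> /ltW ->.
have [t t0h E2] : exists2 t, 0 < t < h &
    'D_u f (x + s *: u + h *: v) - 'D_u f (x + s *: u) =
    'D_v ('D_u f) (x + s *: u + t *: v) * h.
  exact: (@MVT_line ('D_u f) (x + s *: u) v h h0
    (fun t th => Ddf _ (Uh _ _ s0h' th))).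
exists s, t; split=> //.
rewrite -E2 -[LHS]/(g (x + h *: u) - g x) E1; congr (_ * _).
have Us := U1 _ s0h'; have Ush := Uh _ _ s0h' h0h.
have -> : 'D_u g (x + s *: u) = 'D_u (fun y => f (y + h *: v)) (x + s *: u)
    - 'D_u f (x + s *: u).
  by apply: deriveB; apply: diff_derivable; [exact: dsh|exact: df].
suff -> : 'D_u (fun y => f (y + h *: v)) (x + s *: u) =
  'D_u f (x + s *: u + h *: v) by [].
rewrite /derive.
have -> // : (fun k : R => k^-1 *: (((fun y => f (y + h *: v)) \o shift (x + s *: u))
    (k *: u) - f (x + s *: u + h *: v))) =
  (fun k => k^-1 *: ((f \o shift (x + s *: u + h *: v)) (k *: u)
    - f (x + s *: u + h *: v))).
by apply/funext => k /=; congr (_ *: (f _ - _)); rewrite -[in LHS]addrA.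
Qed.

(** The second difference is symmetric in [u] and [v], so [MVT_square] used in both orders gives
    points near [x] at which the two mixed derivatives take a common value. Continuity of both at
    [x] then brings their values at [x] within any [e] of each other. *)
Lemma derive_comm (U : set 'rV[R]_n) f x u v : open U -> U x -> Ck_on 2 U f ->
  'D_u ('D_v f) x = 'D_v ('D_u f) x.
Proof.
move=> oU Ux cf; pose F := 'D_v ('D_u f); pose G := 'D_u ('D_v f).
have [df Df] := cf.
have cF : {for x, continuous F} by case: (Df u) => _ cDu; exact: (cDu v x Ux).
have cG : {for x, continuous G} by case: (Df v) => _ cDv; exact: (cDv u x Ux).
apply/eqP; rewrite -subr_eq0 -normr_le0; apply/ler_addgt0Pl => e e0; rewrite addr0.
have e20 : 0 < e / 2 by rewrite divr_gt0.
have /nbhs_ballP[d /= d0 dP] : nbhs x [set y | [/\ U y, `|F x - F y| < e / 2 &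
    `|G x - G y| < e / 2]].
  have nF : \forall y \near x, `|F x - F y| < e / 2.
    exact: ((cvgrPdist_lt _ _).1 cF).
  have nG : \forall y \near x, `|G x - G y| < e / 2.
    exact: ((cvgrPdist_lt _ _).1 cG).
  have nU := open_near oU Ux.
  apply: filterS (filterI nU (filterI nF nG)).
  by move=> y [Uy [Fy Gy]].
(* As [h * C = d / 2], the whole parallelogram with sides [h *: u] and [h *: v] stays in the ball of
   radius [d]; the [+ 1] keeps [C] positive when [u] and [v] vanish. *)
pose C := `|u| + `|v| + 1.
have C0 : 0 < C by rewrite /C ltr_wpDl// addr_ge0.
pose h := d / 2 / C.
have h0 : 0 < h by rewrite !divr_gt0.
have Bh s t : 0 <= s <= h -> 0 <= t <= h -> ball x d (x + s *: u + t *: v).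
  move=> /andP[s0 sh] /andP[t0 th].
  rewrite -ball_normE/= -addrA opprD addrA subrr sub0r normrN.
  apply: (@le_lt_trans _ _ (h * C)).
    rewrite (le_trans (ler_normD _ _))// !normrZ !ger0_norm//.
    rewrite /C !mulrDr mulr1 -addrA lerD// ?ler_wpM2r//.
    by rewrite ler_wpDr// ?ler_wpM2r// ltW.
  by rewrite /h divfK ?gt_eqF// ltr_pdivrMr// ltr_pMr// ltr1n.
have Bh' s t : 0 <= s <= h -> 0 <= t <= h -> ball x d (x + s *: v + t *: u).
  by move=> *; rewrite addrAC; exact: Bh.
have UB y : ball x d y -> U y by move=> /dP[].
have [s [t [s0 t0 E]]] : exists s t, [/\ 0 < s < h, 0 < t < h &
    (f (x + h *: u + h *: v) - f (x + h *: u)) - (f (x + h *: v) - f x) =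
    F (x + s *: u + t *: v) * h * h].
  exact: MVT_square cf h0 (fun s t sh th => UB _ (Bh s t sh th)).
have [s' [t' [s'0 t'0 E']]] : exists s t, [/\ 0 < s < h, 0 < t < h &
    (f (x + h *: v + h *: u) - f (x + h *: v)) - (f (x + h *: u) - f x) =
    G (x + s *: v + t *: u) * h * h].
  exact: MVT_square cf h0 (fun s t sh th => UB _ (Bh' s t sh th)).
rewrite -[_ - _]/(G x - F x); clearbody F G.
have W r : 0 < r < h -> 0 <= r <= h by case/andP => /ltW -> /ltW ->.
have FG : F (x + s *: u + t *: v) = G (x + s' *: v + t' *: u).
  have hn0 : h != 0 by rewrite gt_eqF.
  apply/(mulIf hn0)/(mulIf hn0); rewrite -E -E' [x + h *: v + h *: u]addrAC.
  by rewrite !opprB addrACA [RHS]addrACA; congr (_ + _); rewrite addrC.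
have [_ Fx _] := dP _ (Bh _ _ (W _ s0) (W _ t0)).
have [_ _ Gx] := dP _ (Bh' _ _ (W _ s'0) (W _ t'0)).
rewrite -(subrKA (G (x + s' *: v + t' *: u))).
rewrite (le_trans (ler_normD _ _))// (splitr e) lerD// ltW//.
by rewrite -FG distrC.
Qed.
End Schwarz.

Lemma derive_comm_row (R : realType) n m (U : set 'rV[R]_n)
  (f : 'rV[R]_n -> 'rV[R]_m) x u v : open U -> U x -> Ck_on 2 U f ->
  'D_u ('D_v f) x = 'D_v ('D_u f) x.
Proof.
move=> oU Ux cf; have [df Df] := cf.
have coordD w y j : U y -> ('D_w f y) 0 j = 'D_w (fun x => f x 0 j : R) y.
  by move=> Uy; rewrite derive_mx ?mxE//; exact/diff_derivable/df.
have coordDD w w' j : ('D_w ('D_w' f) x) 0 j =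
    'D_w ('D_w' (fun x => f x 0 j : R)) x.
  have dDf : differentiable ('D_w' f) x by case: (Df w') => + _; apply.
  rewrite derive_mx ?mxE; last exact: diff_derivable.
  apply: near_eq_derive.
  by near=> y; apply: coordD; near: y; exact: (open_near oU Ux).
apply/rowP => j.
have cfj := (Ck_on_coordP _ _ oU).2 cf j.
have E := derive_comm u v oU Ux cfj.
have Euv := coordDD u v j.
have Evu := coordDD v u j.
exact: (etrans Euv (etrans E (esym Evu))).
Unshelve. all: by end_near. Qed.

(** * The canonical symplectic form on coordinates *)

Section dot.
Variables (R : realType) (m : nat).
Implicit Types u v w : 'rV[R]_m.

Definition dot u v : R := \sum_j u 0 j * v 0 j.

Lemma dotC u v : dot u v = dot v u.
Proof. by apply: eq_bigr => j _; rewrite mulrC. Qed.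

Lemma dot0r u : dot u 0 = 0.
Proof. by rewrite /dot big1// => j _; rewrite mxE mulr0. Qed.

Lemma dot0l u : dot 0 u = 0.
Proof. by rewrite dotC dot0r. Qed.

Lemma dotDl u v w : dot (u + v) w = dot u w + dot v w.
Proof. by rewrite /dot -big_split; apply: eq_bigr => j _; rewrite mxE mulrDl. Qed.

Lemma dotZl a u v : dot (a *: u) v = a * dot u v.
Proof. by rewrite /dot mulr_sumr; apply: eq_bigr => j _; rewrite mxE mulrA. Qed.

Lemma dotNr u v : dot u (- v) = - dot u v.
Proof. by rewrite /dot -sumrN; apply: eq_bigr => j _; rewrite mxE mulrN. Qed.

Lemma dot_delta u j : dot u (delta_mx 0 j) = u 0 j.
Proof.
rewrite /dot (bigD1 j)//= mxE !eqxx mulr1 big1 ?addr0// => i /negPf ij.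
by rewrite mxE ij mulr0.
Qed.

Lemma dot_mulmx u v (A : 'M[R]_m) : dot (u *m A) v = dot u (v *m A^T).
Proof.
have E x y : dot x y = (x *m y^T) 0 0.
  by rewrite mxE; apply: eq_bigr => j _; rewrite mxE.
by rewrite !E trmx_mul trmxK mulmxA.
Qed.
End dot.

Lemma derive_dot (R : realType) (V : normedModType R) m
    (f g : V -> 'rV[R]_m) (x u : V) : differentiable f x -> differentiable g x ->
  'D_u (fun y => dot (f y) (g y)) x = dot ('D_u f x) (g x) + dot (f x) ('D_u g x).
Proof.
move=> df dg.
have dc (h : V -> 'rV[R]_m) j : differentiable h x ->
    derivable (fun y => h y 0 j : R) x u.
  by move=> dh; apply: (derivable_mxP _ _ _).1 => //; exact: diff_derivable.
have -> : (fun y => dot (f y) (g y)) =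
    \sum_(j < m) ((fun y => f y 0 j) * (fun y => g y 0 j)).
  by apply/funext => y; rewrite fct_sumE.
rewrite derive_sum; last by move=> j; apply: derivableM; exact: dc.
rewrite -big_split; apply: eq_bigr => j _.
rewrite deriveM; [|exact: dc|exact: dc].
rewrite !derive_mx; [|exact: diff_derivable|exact: diff_derivable].
by rewrite !mxE addrC; congr (_ + _); rewrite mulrC.
Qed.

Lemma derive_linear_comp (R : realType) (V W W' : normedModType R)
    (L : {linear W -> W'}) (f : V -> W) (x u : V) : continuous L ->
  differentiable f x -> 'D_u (L \o f) x = L ('D_u f x).
Proof.
move=> cL df; have dL : differentiable L (f x) by exact: linear_differentiable.
rewrite [LHS]deriveE; last exact: differentiable_comp.
by rewrite [in LHS]diff_comp//= diff_lin// [in RHS]deriveE.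
Qed.

Lemma derive_comp_linear (R : realType) (V V' W : normedModType R)
    (L : {linear V -> V'}) (f : V' -> W) (x u : V) : continuous L ->
  differentiable f (L x) -> 'D_u (f \o L) x = 'D_(L u) f (L x).
Proof.
move=> cL df; have dL : differentiable L x by exact: linear_differentiable.
rewrite [LHS]deriveE; last exact: differentiable_comp.
by rewrite [in LHS]diff_comp//= diff_lin// [in RHS]deriveE.
Qed.

Section canonical_form.
Variables (R : realType) (m : nat).
Implicit Types u v w z : 'rV[R]_(m + m).

(** The constant form sum dx_j /\ dxi_j, positions x in the left block and momenta xi in the right
    one. *)
Definition canonical_form u v : R :=
  dot (lsubmx u) (rsubmx v) - dot (lsubmx v) (rsubmx u).

Lemma canonical_form_alt u : canonical_form u u = 0.
Proof. by rewrite /canonical_form subrr. Qed.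

Lemma canonical_formC u v : canonical_form u v = - canonical_form v u.
Proof. by rewrite /canonical_form opprB. Qed.

Lemma canonical_form_scalar u : scalar (canonical_form u).
Proof.
move=> a v w; rewrite /canonical_form !linearD/= !linearZ/=.
rewrite dotDl dotZl ![dot (lsubmx u) _]dotC dotDl dotZl.
by ring.
Qed.

Lemma canonical_form_scalarl v : scalar (canonical_form ^~ v).
Proof.
move=> a u w; rewrite !(canonical_formC _ v) canonical_form_scalar.
by rewrite opprD -scalerN.
Qed.

(** The symplectic gradient: for G = dH this is (dH/dxi, - dH/dx), the right-hand side of Hamilton's
    equations. *)
Definition canonical_sharp (G : 'rV[R]_(m + m) -> R) : 'rV[R]_(m + m) :=
  row_mx (\row_j G (row_mx 0 (delta_mx 0 j)))
         (- \row_j G (row_mx (delta_mx 0 j) 0)).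

Lemma canonical_sharpP (G : {linear 'rV[R]_(m + m) -> R}) w :
  canonical_form (canonical_sharp G) w = G w.
Proof.
rewrite /canonical_form /canonical_sharp row_mxKl row_mxKr dotNr opprK.
rewrite -[in RHS](hsubmxK w) addrC.
have -> : row_mx (lsubmx w) (rsubmx w) =
    row_mx (lsubmx w) 0 + row_mx 0 (rsubmx w).
  by rewrite add_row_mx addr0 add0r.
rewrite linearD; congr (_ + _).
  rewrite {2}(row_sum_delta (lsubmx w)).
  rewrite (big_morph (fun x : 'rV[R]_m => G (row_mx x 0)) (id1 := 0) (op1 := +%R)).
  - apply: eq_bigr => j _; rewrite [X in _ * X]mxE.
    rewrite (_ : row_mx (_ *: _) 0 = lsubmx w 0 j *: row_mx (delta_mx 0 j) 0).
      by rewrite linearZ.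
    by rewrite scale_row_mx scaler0.
  - by move=> x y; rewrite -linearD add_row_mx addr0.
  - by rewrite row_mx0 linear0.
rewrite [LHS]dotC {2}(row_sum_delta (rsubmx w)).
rewrite (big_morph (fun x : 'rV[R]_m => G (row_mx 0 x)) (id1 := 0) (op1 := +%R)).
- apply: eq_bigr => j _; rewrite [X in _ * X]mxE.
  rewrite (_ : row_mx 0 (_ *: _) = rsubmx w 0 j *: row_mx 0 (delta_mx 0 j)).
    by rewrite linearZ.
  by rewrite scale_row_mx scaler0.
- by move=> x y; rewrite -linearD add_row_mx addr0.
- by rewrite row_mx0 linear0.
Qed.

(** Nondegeneracy, by pairing with basis vectors. Besides its role in [symplectic], it serves to
    identify Hamiltonian vectors through their pairings. *)
Lemma canonical_form_inj u v :
  (forall w, canonical_form u w = canonical_form v w) -> u = v.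
Proof.
move=> uv; rewrite -(hsubmxK u) -(hsubmxK v); congr row_mx; apply/rowP => j.
  have := uv (row_mx 0 (delta_mx 0 j)).
  by rewrite /canonical_form !row_mxKl !row_mxKr !dot0l !subr0 !dot_delta.
have := uv (row_mx (delta_mx 0 j) 0).
rewrite /canonical_form !row_mxKl !row_mxKr !dot0r !sub0r => /oppr_inj.
by rewrite dotC dot_delta dotC dot_delta.
Qed.

(* Differentiating the hypothesis on [eta] in the direction [u] gives
   [dot (w Dtau) (D_u eta) = dot w (rsubmx u) - dot (D^2 tau (lsubmx u) w) eta];
   the second-order terms cancel by symmetry of [D^2 tau]. *)
Lemma cotangent_lift_symplectic (U : set 'rV[R]_m) (tau : 'rV[R]_m -> 'rV[R]_m)
    (eta : 'rV[R]_(m + m) -> 'rV[R]_m) z u v :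
  open U -> U (lsubmx z) -> Ck_on 2 U tau -> differentiable eta z ->
  (forall w : 'rV[R]_m, \forall y \near z,
     dot ('D_w tau (lsubmx y)) (eta y) = dot w (rsubmx y)) ->
  let T y := row_mx (tau (lsubmx y)) (eta y) in
  differentiable T z ->
  canonical_form ('D_u T z) ('D_v T z) = canonical_form u v.
Proof.
move=> oU Uz ctau deta etaP T dT; have [dtau Dtau] := ctau.
have dl : differentiable (lsubmx : _ -> 'rV[R]_m) z by exact: differentiable_lsubmx.
have l_ a : lsubmx ('D_a T z) = 'D_(lsubmx a) tau (lsubmx z).
  rewrite -(derive_linear_comp _ (@continuous_lsubmx _ 1 m m) dT).
  rewrite (_ : lsubmx \o T = tau \o lsubmx); last first.
    by apply/funext => y /=; rewrite row_mxKl.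
  by rewrite derive_comp_linear//; [exact: continuous_lsubmx|exact: dtau].
have r_ a : rsubmx ('D_a T z) = 'D_a eta z.
  rewrite -(derive_linear_comp _ (@continuous_rsubmx _ 1 m m) dT).
  by rewrite (_ : rsubmx \o T = eta)//; apply/funext => y /=; rewrite row_mxKr.
have key (w : 'rV[R]_m) a : dot ('D_w tau (lsubmx z)) ('D_a eta z) =
    dot w (rsubmx a) - dot ('D_(lsubmx a) ('D_w tau) (lsubmx z)) (eta z).
  have dDw : differentiable ('D_w tau) (lsubmx z) by case: (Dtau w) => + _; apply.
  have := @derive_dot _ _ _ ('D_w tau \o lsubmx) eta z a
    (differentiable_comp dl dDw) deta.
  rewrite (near_eq_derive a (etaP w)).
  have -> : 'D_a (fun y => dot w (rsubmx y)) z = dot w (rsubmx a).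
    rewrite (@derive_dot _ _ _ (cst w)); last 2 first.
    - exact: differentiable_cst.
    - exact: differentiable_rsubmx.
    rewrite derive_cst dot0l add0r deriveE; last exact: differentiable_rsubmx.
    by rewrite diff_lin//; exact: continuous_rsubmx.
  rewrite derive_comp_linear//; last exact: continuous_lsubmx.
  by move=> ->; rewrite addrAC subrr add0r.
have E := derive_comm_row (lsubmx u) (lsubmx v) oU Uz ctau.
have K1 := key (lsubmx u) v.
have K2 := key (lsubmx v) u.
rewrite -E in K1.
have S1 := etrans (congr2 (@dot R m) (l_ u) (r_ v)) K1.
have S2 := etrans (congr2 (@dot R m) (l_ v) (r_ u)) K2.
refine (etrans (congr2 (fun a b : R => a - b) S1 S2) _).
by rewrite opprB addrA subrK.
Qed.
End canonical_form.

(** * Changes of charts *)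

Lemma open_setI_preimage (T T' : topologicalType) (U : set T) (f : T -> T')
    (B : set T') : open U -> (forall x, U x -> {for x, continuous f}) ->
  open B -> open (U `&` f @^-1` B).
Proof.
move=> oU cf oB; rewrite openE => x [Ux Bfx]; apply: filterI.
  exact: open_nbhs_nbhs.
by apply: (cf x Ux); exact: open_nbhs_nbhs.
Qed.

Lemma Ck_on_row_mx (R : realType) n m1 m2 k (U : set 'rV[R]_n)
    (f : 'rV[R]_n -> 'rV[R]_m1) (g : 'rV[R]_n -> 'rV[R]_m2) :
  open U -> Ck_on k U f -> Ck_on k U g -> Ck_on k U (fun x => row_mx (f x) (g x)).
Proof.
move=> oU cf cg; apply: (Ck_on_coordP _ _ oU).1 => j.
have [i ->|i ->] := split_ordP j.
  apply: Ck_on_ext ((Ck_on_coordP _ _ oU).2 cf i) => // x _.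
  by rewrite row_mxEl.
apply: Ck_on_ext ((Ck_on_coordP _ _ oU).2 cg i) => // x _.
by rewrite row_mxEr.
Qed.

(* Locked, as unification would otherwise unfold the differentials whenever it
   compares the Jacobians of distinct pairs of charts. *)
HB.lock Definition jac (R : realType) (m : nat) (M : manifold R m)
    (c d : chart R M m) (p : M) : 'M[R]_m :=
  'J (cmap d \o cinv c) (cmap c p).

Section charts.
Variables (R : realType) (m : nat) (M : manifold R m).
Implicit Types (c d e : chart R M m) (p : M).

Definition overlap c d : set 'rV[R]_m := ccod c `&` cinv c @^-1` cdom d.

Lemma open_overlap c d : open (overlap c d).
Proof.
apply: open_setI_preimage; [exact: ccod_open|exact: cinv_continuous|exact: cdom_open].
Qed.

Lemma overlapP c d p : cdom c p -> cdom d p -> overlap c d (cmap c p).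
Proof. by move=> cp dp; split; [exact: cmap_fun|rewrite /= cmapK]. Qed.

Lemma diff_transition c d p v :
  'd (cmap d \o cinv c) (cmap c p) v = v *m jac c d p.
Proof. by rewrite jac.unlock /jacobian mul_rV_lin1. Qed.

Lemma differentiable_transition c d p : atlas c -> atlas d ->
  cdom c p -> cdom d p -> differentiable (cmap d \o cinv c) (cmap c p).
Proof.
move=> ac ad cp dp; have [dt _] := atlas_compatible ac ad 1.
exact: (dt _ (overlapP cp dp)).
Qed.

(** The chain rule for the factorization of [f \o cinv c] through the transition from [c] to [d],
    which is valid only on the overlap, hence near [cmap c p]. *)
Lemma diff_change_chart (W : normedModType R) (f : M -> W) c d p :
  atlas c -> atlas d -> cdom c p -> cdom d p ->
  differentiable (f \o cinv d) (cmap d p) ->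
  forall v, 'd (f \o cinv c) (cmap c p) v =
            'd (f \o cinv d) (cmap d p) (v *m jac c d p).
Proof.
move=> ac ad cp dp df v.
have dt := differentiable_transition ac ad cp dp.
have E : (cmap d \o cinv c) (cmap c p) = cmap d p by rewrite /= cmapK.
have df' : differentiable (f \o cinv d) ((cmap d \o cinv c) (cmap c p)).
  by rewrite E.
have dfg := differentiable_comp dt df'.
have ng : \forall x \near cmap c p,
    ((f \o cinv d) \o (cmap d \o cinv c)) x = (f \o cinv c) x.
  near=> x; rewrite /= cmapK//.
  suff [] : overlap c d x by [].
  by near: x; exact: (open_near (@open_overlap c d) (overlapP cp dp)).
have [_ H] := near_eq_diff ng dfg.
refine (etrans (congr1 (fun L => L v) H) _).
refine (etrans (congr1 (fun L => L v) (diff_comp dt df')) _).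
by rewrite /= -diff_transition cmapK.
Unshelve. all: by end_near. Qed.

(** The cocycle rule is [diff_change_chart] for the map [cmap e]. Together with [jac_id] it makes
    [jac d c p] the inverse of [jac c d p], so later cancellations need no matrix inverse. *)
Lemma jacM c d e p : atlas c -> atlas d -> atlas e ->
  cdom c p -> cdom d p -> cdom e p -> jac c d p *m jac d e p = jac c e p.
Proof.
move=> ac ad ae cp dp ep; have de := differentiable_transition ad ae dp ep.
have H (v : 'rV[R]_m) : v *m (jac c d p *m jac d e p) = v *m jac c e p.
  rewrite mulmxA -(diff_transition d e p (v *m jac c d p)).
  rewrite -(diff_transition c e p v).
  exact: (esym (diff_change_chart ac ad cp dp de v)).
by apply/row_matrixP => i; rewrite !rowE H.
Qed.

Lemma jac_id c p : cdom c p -> jac c c p = 1%:M.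
Proof.
move=> cp; have ng : \forall x \near cmap c p, id x = (cmap c \o cinv c) x.
  near=> x; rewrite /= cinvK//; near: x.
  exact: (open_near (@ccod_open _ _ _ c) (cmap_fun cp)).
have [_ H] := near_eq_diff ng (@ex_diff _ _ _ _ _ _ _ (is_diff_id (cmap c p))).
apply/row_matrixP => i; rewrite !rowE mulmx1.
rewrite -(diff_transition c c p (delta_mx 0 i)).
refine (etrans (congr1 (fun L => L (delta_mx 0 i)) H) _).
by rewrite diff_val.
Unshelve. all: by end_near. Qed.

End charts.
Arguments open_overlap {R m M} c d.

(** * The cotangent bundle *)

Section lift.
Variables (R : realType) (m : nat) (M : manifold R m).
Implicit Types (c d e : chart R M m) (p : M).

(* The second component is a covector at the first one, [p], in the coordinates
   of [chart_at p]; hence the topology is not the product topology. *)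
Definition cotangent : Type := (M * 'rV[R]_m)%type.
HB.instance Definition _ := Choice.copy cotangent (M * 'rV[R]_m)%type.

(* A covector [xi] acts on row vectors by [dot xi], hence the transposes. *)
Definition lift_map c (P : cotangent) : 'rV[R]_(m + m) :=
  row_mx (cmap c P.1) (P.2 *m (jac c (chart_at P.1) P.1)^T).

Definition lift_inv c (z : 'rV[R]_(m + m)) : cotangent :=
  (cinv c (lsubmx z),
   rsubmx z *m (jac (chart_at (cinv c (lsubmx z))) c (cinv c (lsubmx z)))^T).

Definition lift_dom c : set cotangent := [set P | cdom c P.1].
Definition lift_cod c : set 'rV[R]_(m + m) := [set z | ccod c (lsubmx z)].

(** The transition between the lifts of [c] and [d], with [chart_at] eliminated: only in this form
    is it visibly smooth. Covectors are pulled back, hence [jac d c] instead of [jac c d]. *)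
Definition lift_transition c d (z : 'rV[R]_(m + m)) : 'rV[R]_(m + m) :=
  row_mx ((cmap d \o cinv c) (lsubmx z))
         (rsubmx z *m (jac d c (cinv c (lsubmx z)))^T).

(** The final topology for the parametrizations [lift_inv c] restricted to [lift_cod c]. *)
Definition cotangent_open (O : set cotangent) : Prop :=
  forall c, atlas c -> open (lift_cod c `&` lift_inv c @^-1` O).

Lemma open_lsubmx_preimage (U : set 'rV[R]_m) : open U ->
  open [set z : 'rV[R]_(m + m) | U (lsubmx z)].
Proof.
move=> oU; apply: (@open_comp _ _ (lsubmx : 'rV[R]_(m + m) -> 'rV[R]_m)) => //.
by move=> z _; exact: continuous_lsubmx.
Qed.

Lemma open_lift_cod c : open (lift_cod c).
Proof. by apply: open_lsubmx_preimage; exact: ccod_open. Qed.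

Arguments open_lift_cod : clear implicits.

Fact cotangent_openT : cotangent_open setT.
Proof. by move=> c ac; rewrite preimage_setT setIT; exact: open_lift_cod. Qed.

Fact cotangent_openI (A B : set cotangent) :
  cotangent_open A -> cotangent_open B -> cotangent_open (A `&` B).
Proof.
move=> oA oB c ac; rewrite preimage_setI setIIr.
by apply: openI; [exact: oA|exact: oB].
Qed.

Fact cotangent_open_bigU (I : Type) (f : I -> set cotangent) :
  (forall i, cotangent_open (f i)) -> cotangent_open (\bigcup_i f i).
Proof.
move=> of_ c ac; rewrite preimage_bigcup setI_bigcupr.
by apply: bigcup_open => i _; exact: of_.
Qed.

HB.instance Definition _ := isOpenTopological.Build cotangent
  cotangent_openT cotangent_openI cotangent_open_bigU.

Lemma cotangent_openE (O : set cotangent) : open O = cotangent_open O.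
Proof. by []. Qed.

Lemma lift_mapK c P : atlas c -> lift_dom c P -> lift_inv c (lift_map c P) = P.
Proof.
case: P => p xi ac cp; rewrite /lift_inv /lift_map row_mxKl row_mxKr /= cmapK//.
have ae := chart_at_atlas p; have ep := chart_at_dom p.
by rewrite -mulmxA -trmx_mul jacM// jac_id// trmx1 mulmx1.
Qed.

Lemma lift_map_inv c d z : atlas c -> atlas d -> lift_cod c z ->
  cdom d (cinv c (lsubmx z)) -> lift_map d (lift_inv c z) = lift_transition c d z.
Proof.
move=> ac ad cz dz; have cp := cinv_fun cz.
rewrite /lift_map /lift_transition /=; congr row_mx.
by rewrite -mulmxA -trmx_mul jacM//; [exact: chart_at_atlas|exact: chart_at_dom].
Qed.

Lemma lift_invK c z : atlas c -> lift_cod c z -> lift_map c (lift_inv c z) = z.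
Proof.
move=> ac cz; have cp := cinv_fun cz.
rewrite (lift_map_inv ac ac)// /lift_transition jac_id// trmx1 mulmx1 /= cinvK//.
by rewrite hsubmxK.
Qed.

Lemma open_lift_overlap c d :
  open [set z : 'rV[R]_(m + m) | overlap c d (lsubmx z)].
Proof. by apply: open_lsubmx_preimage; exact: open_overlap. Qed.

Arguments open_lift_overlap : clear implicits.

(** The entry is the j-th coordinate of the i-th partial derivative of the transition from [c] to
    [d], precomposed with the transition from [d] to [c] so as to be read in the chart [d]. The
    derivative costs one order, hence compatibility at [k.+1]. *)
Lemma Ck_on_jac c d k i j : atlas c -> atlas d ->
  Ck_on k (overlap d c) (fun x => jac c d (cinv d x) i j : R).
Proof.
move=> ac ad; have o := open_overlap d c.
have oc := open_overlap c d.
have [_ /(_ (delta_mx 0 i)) DJ] := atlas_compatible ac ad k.+1.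
have Dj := (Ck_on_coordP _ _ oc).2 DJ j.
apply: Ck_on_ext (Ck_on_comp_scalar o _ (atlas_compatible ad ac k) Dj) => //.
  move=> x [dx cx] /=.
  have dp := cinv_fun dx.
  rewrite deriveE; last exact: differentiable_transition.
  by rewrite diff_transition -rowE mxE.
move=> x [dx cx]; apply: overlapP => //; exact: cinv_fun.
Qed.

Lemma lift_transition_smooth c d : atlas c -> atlas d ->
  smooth_on [set z : 'rV[R]_(m + m) | overlap c d (lsubmx z)]
    (lift_transition c d).
Proof.
move=> ac ad k; have o := open_lift_overlap c d.
have cl : Ck_on k [set z : 'rV[R]_(m + m) | overlap c d (lsubmx z)]
    (lsubmx : 'rV[R]_(m + m) -> 'rV[R]_m).
  by apply: Ck_on_linear; exact: continuous_lsubmx.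
have cr : Ck_on k [set z : 'rV[R]_(m + m) | overlap c d (lsubmx z)]
    (rsubmx : 'rV[R]_(m + m) -> 'rV[R]_m).
  by apply: Ck_on_linear; exact: continuous_rsubmx.
apply: Ck_on_row_mx => //.
  by apply: (Ck_on_comp o (open_overlap c d) _ cl) => //; exact: atlas_compatible.
apply: (Ck_on_coordP _ _ o).1 => j.
apply: (@Ck_on_ext _ _ _ _ _ (fun z : 'rV[R]_(m + m) =>
    \sum_i rsubmx z 0 i * jac d c (cinv c (lsubmx z)) j i)) => //.
  by move=> z _; rewrite mxE; apply: eq_bigr => i _; rewrite [X in _ = _ * X]mxE.
apply: Ck_on_sum => // i; apply: Ck_onM => //.
  exact: ((Ck_on_coordP _ _ o).2 cr i).
exact: (Ck_on_comp_scalar o _ cl (Ck_on_jac k j i ad ac)).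
Qed.

Lemma lift_map_fun c P : lift_dom c P -> lift_cod c (lift_map c P).
Proof. by move=> cP; rewrite /lift_cod /= row_mxKl; exact: cmap_fun. Qed.

Lemma lift_inv_fun c z : lift_cod c z -> lift_dom c (lift_inv c z).
Proof. exact: cinv_fun. Qed.

(** Openness is tested in each chart [d], where the set becomes the preimage of [B] under
    [lift_transition d c], which is continuous on an open set. This yields both the openness of
    [lift_dom c] and the continuity of [lift_map c]. *)
Lemma open_lift_dom_preimage c (B : set 'rV[R]_(m + m)) : atlas c -> open B ->
  open (lift_dom c `&` lift_map c @^-1` B).
Proof.
rewrite cotangent_openE => ac oB d ad.
rewrite (_ : _ `&` _ = [set z : 'rV[R]_(m + m) | overlap d c (lsubmx z)] `&`
    lift_transition d c @^-1` B); last first.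
  apply/seteqP; split=> z /=.
    by move=> [dz [cz Bz]]; rewrite -lift_map_inv.
  by move=> [[dz cz] Bz]; rewrite -lift_map_inv// in Bz.
apply: open_setI_preimage => //; first exact: open_lift_overlap.
by move=> z oz; exact: (lift_transition_smooth ad ac 0%N).
Qed.

Lemma open_lift_dom c : atlas c -> open (lift_dom c).
Proof.
by move=> ac; have := open_lift_dom_preimage ac openT; rewrite preimage_setT setIT.
Qed.

Lemma lift_map_continuous c P : atlas c -> lift_dom c P ->
  {for P, continuous (lift_map c)}.
Proof.
move=> ac cP A /=; rewrite nbhsE => -[B [oB BP] BA].
rewrite nbhs_simpl /= nbhsE; exists (lift_dom c `&` lift_map c @^-1` B).
  by split; [exact: open_lift_dom_preimage|].
by move=> Q [_ /BA].
Qed.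

Lemma lift_inv_continuous c z : atlas c -> lift_cod c z ->
  {for z, continuous (lift_inv c)}.
Proof.
move=> ac cz A /=; rewrite nbhsE => -[B [oB Bz] BA].
rewrite cotangent_openE in oB.
have := @open_nbhs_nbhs _ z (lift_cod c `&` lift_inv c @^-1` B).
move=> /(_ (conj (oB c ac) (conj cz Bz))).
by apply: filterS => y [_ /BA].
Qed.

Definition lift_chart c (ac : atlas c) : chart R cotangent (m + m) :=
  Chart (open_lift_dom ac) (open_lift_cod c) (@lift_map_fun c) (@lift_inv_fun c)
    (fun P => lift_mapK ac) (fun z => lift_invK ac)
    (fun P => lift_map_continuous ac) (fun z => lift_inv_continuous ac).

Definition cotangent_atlas : set (chart R cotangent (m + m)) :=
  [set C | exists c (ac : atlas c), C = lift_chart ac].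

Definition cotangent_chart_at (P : cotangent) : chart R cotangent (m + m) :=
  lift_chart (chart_at_atlas P.1).

Lemma cotangent_compatible C D : cotangent_atlas C -> cotangent_atlas D ->
  smooth_on (ccod C `&` cinv C @^-1` cdom D) (cmap D \o cinv C).
Proof.
move=> [c [ac ->]] [d [ad ->]] k /=.
apply: Ck_on_ext (lift_transition_smooth ac ad k).
  exact: open_lift_overlap.
by move=> z [cz dz] /=; rewrite lift_map_inv.
Qed.
End lift.
Arguments open_lift_cod {R m M} c.
Arguments open_lift_overlap {R m M} c d.

(** * Separation and countability of the cotangent bundle *)

(** Boxes with rational corners form a base: balls for the sup norm are themselves boxes, so the
    corners can be chosen one coordinate at a time, within [e] on either side of [v]. *)
Lemma second_countable_rV (R : realType) n : @second_countable 'rV[R]_n.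
Proof.
pose box (q : {ffun 'I_n -> rat * rat}) : set 'rV[R]_n :=
  [set v | forall i, v 0 i \in `]ratr (q i).1, ratr (q i).2[%R].
exists (box @` setT).
  exact: sub_countable (card_image_le _ _) (countableP _).
split=> [_ [q _ <-]|v A].
  rewrite openE => v vq; exists (fun _ i => `]ratr (q i).1, ratr (q i).2[%classic).
    move=> i j; rewrite ord1; apply: open_nbhs_nbhs; split; last exact: vq.
    exact: interval_open.
  by move=> w wq i; exact: wq.
move=> /nbhs_ballP[e /= e0 eA].
have q i : exists q : rat * rat, v 0 i - e < ratr q.1 < v 0 i /\
    v 0 i < ratr q.2 < v 0 i + e.
  have /rat_in_itvoo[q1 q1P] : v 0 i - e < v 0 i by rewrite ltrBlDr ltrDl.
  have /rat_in_itvoo[q2 q2P] : v 0 i < v 0 i + e by rewrite ltrDl.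
  by exists (q1, q2); rewrite !in_itv/= in q1P q2P.
have [f fP] := choice q.
exists (box (finfun f)).
  split; first by exists (finfun f).
  move=> i; rewrite ffunE in_itv/=.
  by have [/andP[_ ->] /andP[-> _]] := fP i.
move=> w wf; apply: eA; split=> // i j; rewrite ord1.
have := wf j; rewrite ffunE in_itv/= => /andP[w1 w2].
have [/andP[f1 _] /andP[_ f2]] := fP j.
rewrite /ball/= distrC ltr_distl; apply/andP; split.
  exact: lt_trans f1 w1.
exact: lt_trans w2 f2.
Qed.

Section cotangent_bundle.
Variables (R : realType) (m : nat) (M : manifold R m).

(** Continuity of the bundle projection. *)
Lemma cotangent_fst_open (U : set M) : open U ->
  open [set P : cotangent M | U P.1].
Proof.
rewrite cotangent_openE => oU c ac.
rewrite (_ : _ `&` _ =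
  [set z : 'rV[R]_(m + m) | (ccod c `&` cinv c @^-1` U) (lsubmx z)]) //.
apply: open_lsubmx_preimage; apply: open_setI_preimage => //.
  exact: ccod_open.
exact: cinv_continuous.
Qed.

(** Points over distinct base points are separated by preimages of open sets of [M]; two points of
    the same fibre lie in one lifted chart and are separated by their coordinates. *)
Lemma cotangent_hausdorff : hausdorff_space (cotangent M).
Proof.
rewrite open_hausdorff => P Q PQ.
have [PQ1|PQ1] := eqVneq P.1 Q.1; last first.
  have := @manifold_hausdorff R m M; rewrite open_hausdorff => /(_ _ _ PQ1).
  move=> [[A B] /= [PA QB] [oA oB /eqP AB]].
  rewrite !inE in PA QB.
  exists ([set P | A P.1], [set P | B P.1]) => /=; first by rewrite !inE.
  split; [exact: cotangent_fst_open|exact: cotangent_fst_open|].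
  apply/eqP/seteqP; split=> // S /= ABS.
  by have : (A `&` B) S.1 by []; rewrite AB.
pose c := chart_at P.1; have ac : atlas c := chart_at_atlas P.1.
have cP : lift_dom c P := chart_at_dom P.1.
have cQ : lift_dom c Q by rewrite /lift_dom /= -PQ1; exact: chart_at_dom.
have lPQ : lift_map c P != lift_map c Q.
  apply: contra_neq PQ => E.
  by rewrite -(lift_mapK ac cP) -(lift_mapK ac cQ) E.
have := @norm_hausdorff R 'rV[R]_(m + m).
rewrite open_hausdorff => /(_ _ _ lPQ)[[A B] /= [PA QB] [oA oB /eqP AB]].
rewrite !inE in PA QB.
exists (lift_dom c `&` lift_map c @^-1` A, lift_dom c `&` lift_map c @^-1` B) => /=.
  by rewrite !inE.
split; [exact: open_lift_dom_preimage|exact: open_lift_dom_preimage|].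
apply/eqP/seteqP; split=> // S /= [[_ AS] [_ BS]].
by have : (A `&` B) (lift_map c S) by []; rewrite AB.
Qed.

(** The base is indexed by pairs of a basic open set [U] of [M] and a rational box. One chart whose
    domain contains [U] is chosen for each [U], so a possibly uncountable atlas does not enter the
    indexing; a [U] lying in no chart domain contributes [set0]. *)
Lemma cotangent_second_countable : @second_countable (cotangent M).
Proof.
have [B cB [oB nB]] := @manifold_second_countable R m M.
have [Q cQ [oQ nQ]] := @second_countable_rV R (m + m).
pose F (UV : set M * set 'rV[R]_(m + m)) : set (cotangent M) :=
  match pselect (exists c, atlas c /\ UV.1 `<=` cdom c) with
  | left h => [set P | UV.1 P.1] `&`
      (lift_dom (projT1 (cid h)) `&` lift_map (projT1 (cid h)) @^-1` UV.2)
  | right _ => set0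
  end.
exists (F @` (B `*` Q)); first by apply: sub_countable (card_image_le _ _) _; exact: countableX.
split=> [_ [[U V] [/= BU QV] <-]|P A].
  rewrite /F; case: pselect => [h|_] /=; last exact: open0.
  apply: openI; first exact/cotangent_fst_open/oB.
  apply: open_lift_dom_preimage; last exact: oQ.
  by case: cid => c [].
rewrite nbhsE => -[W [oW WP] WA].
have /nB[U [BU UP] /= Uc] : nbhs P.1 (cdom (chart_at P.1)).
  by apply: open_nbhs_nbhs; split; [exact: cdom_open|exact: chart_at_dom].
have h : exists c, atlas c /\ U `<=` cdom c.
  by exists (chart_at P.1); split => //; exact: chart_at_atlas.
(* This is the chart that [F] chose for [U], possibly different from [chart_at P.1]; it serves
   equally well since its domain contains [U]. *)
pose c := projT1 (cid h); have [ac cU] : atlas c /\ U `<=` cdom c := projT2 (cid h).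
have cP : lift_dom c P by exact: cU.
have /nQ[V [QV VP] /= VW] : nbhs (lift_map c P) (lift_cod c `&` lift_inv c @^-1` W).
  apply: open_nbhs_nbhs; split; first exact: (oW c ac).
  by split; [exact: lift_map_fun|rewrite /= lift_mapK].
have FUV : F (U, V) = [set P | U P.1] `&` (lift_dom c `&` lift_map c @^-1` V).
  rewrite /F; case: pselect => // h'.
  by rewrite (Prop_irrelevance h' h).
exists (F (U, V)); first by split; [exists (U, V)|rewrite FUV].
rewrite FUV => S [_ [cS /VW[_ /=]]].
by rewrite lift_mapK// => /WA.
Qed.

Lemma cotangent_chart_at_atlas (P : cotangent M) :
  cotangent_atlas (cotangent_chart_at P).
Proof. by exists (chart_at P.1), (chart_at_atlas P.1). Qed.

Lemma cotangent_chart_at_dom (P : cotangent M) : cdom (cotangent_chart_at P) P.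
Proof. exact: chart_at_dom. Qed.

Definition cotangent_bundle : manifold R (m + m) :=
  Manifold cotangent_hausdorff cotangent_second_countable
    cotangent_chart_at_atlas cotangent_chart_at_dom (@cotangent_compatible R m M).
End cotangent_bundle.

(** * The canonical two-form *)

Section tangent.
Variables (R : realType) (n : nat) (N : manifold R n).

Lemma dchartE (c : chart R N n) (p : N) (v : tangent_space p) :
  dchart c v = (v : 'rV[R]_n) *m jac (chart_at p) c p.
Proof. exact: diff_transition. Qed.

Lemma dparamE (c : chart R N n) x u : ccod c x ->
  dparam c x u = u *m jac c (chart_at (cinv c x)) (cinv c x) :> 'rV[R]_n.
Proof.
by move=> cx; rewrite -(diff_transition c (chart_at (cinv c x)) (cinv c x) u) cinvK.
Qed.
End tangent.

Section canonical_two_form.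
Variables (R : realType) (m : nat) (M : manifold R m).
Local Notation N := (cotangent_bundle M).

(** This is [cotangent_lift_symplectic] with [tau] the transition on [M] and [eta] the momentum part
    of its lift. The hypothesis on [eta], that the pairing of vectors and covectors is preserved,
    amounts to the cancellation of [jac c d] with [jac d c]. *)
Lemma jac_lift_symplectic (c d : chart R M m) (ac : atlas c) (ad : atlas d)
    (P : N) u v : cdom c P.1 -> cdom d P.1 ->
  canonical_form (u *m jac (M := N) (lift_chart ac) (lift_chart ad) P)
                 (v *m jac (M := N) (lift_chart ac) (lift_chart ad) P) =
  canonical_form u v.
Proof.
move=> cP dP; pose z := lift_map c P.
have zo : overlap c d (lsubmx z) by rewrite row_mxKl; exact: overlapP.
have o := open_lift_overlap c d.
have sT := lift_transition_smooth ac ad.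
have dT : differentiable (lift_transition c d) z by case: (sT 1) => + _; apply.
have JE w : w *m jac (M := N) (lift_chart ac) (lift_chart ad) P =
    'D_w (lift_transition c d) z.
  refine (etrans (esym (diff_transition (M := N) _ _ _ _)) _).
  refine (etrans _ (esym (deriveE w dT))).
  have nT : \forall y \near z, lift_transition c d y = (lift_map d \o lift_inv c) y.
    near=> y; have [cy dy] : overlap c d (lsubmx y).
      by near: y; exact: (open_near o zo).
    by rewrite /= lift_map_inv.
  by have [_ H] := near_eq_diff nT dT; exact: (congr1 (fun L => L w) H).
rewrite (JE u) (JE v).
pose eta (y : 'rV[R]_(m + m)) := rsubmx y *m (jac d c (cinv c (lsubmx y)))^T.
have deta : differentiable eta z.
  have -> : eta = rsubmx \o lift_transition c d.
    by apply/funext => y /=; rewrite row_mxKr.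
  exact: (differentiable_comp dT (differentiable_rsubmx _)).
refine (@cotangent_lift_symplectic R m (overlap c d) (cmap d \o cinv c) eta z u v
  (open_overlap c d) zo (atlas_compatible ac ad 2) deta _ dT).
move=> w; near=> y.
have [cy dy] : overlap c d (lsubmx y) by near: y; exact: (open_near o zo).
have cp := cinv_fun cy.
have Dw : 'D_w (cmap d \o cinv c) (lsubmx y) = w *m jac c d (cinv c (lsubmx y)).
  rewrite -(diff_transition c d (cinv c (lsubmx y)) w) (cinvK cy).
  apply: deriveE; rewrite -[X in differentiable _ X](cinvK cy).
  exact: differentiable_transition.
rewrite Dw dot_mulmx.
by rewrite -mulmxA -trmx_mul jacM// jac_id// trmx1 mulmx1.
Unshelve. all: by end_near. Qed.

(** One constant formula in the coordinates of the distinguished chart at each point;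
    [jac_lift_symplectic] makes that choice of chart immaterial. *)
Definition canonical_form_at (P : N) (u v : tangent_space P) : R :=
  canonical_form (u : 'rV[R]_(m + m)) v.

(** The coefficients are thus constant on each lifted chart, from which both the smoothness and the
    closedness of the form follow. *)
Lemma local_canonical_form (C : chart R N (m + m)) u v z :
  atlas C -> ccod C z ->
  local_form canonical_form_at C u v z = canonical_form u v.
Proof.
move=> [c [ac ->]] cz; rewrite /local_form /canonical_form_at.
rewrite (dparamE (N := N) u cz) (dparamE (N := N) v cz).
apply: jac_lift_symplectic; first exact: (lift_inv_fun cz).
exact: chart_at_dom.
Qed.

Lemma canonical_is_two_form : is_two_form canonical_form_at.
Proof.
split.
- by move=> p u; exact: canonical_form_scalar.
- by move=> p v; exact: canonical_form_scalarl.
- by move=> p u; exact: canonical_form_alt.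
- move=> C u v aC k.
  apply: (@Ck_on_ext _ _ _ _ _ (fun=> canonical_form u v)).
  + exact: ccod_open.
  + by move=> z cz; rewrite local_canonical_form.
  + exact: Ck_on_cst.
Qed.

Definition canonical_two_form : two_form N := TwoForm canonical_is_two_form.

Lemma canonical_symplectic : symplectic canonical_two_form.
Proof.
split=> [P u u0|C x u v w aC Cx].
  apply: canonical_form_inj => w; rewrite [LHS](u0 w).
  by rewrite /canonical_form !linear0 dot0l dot0r subrr.
have D0 a b e : 'D_e (local_form canonical_two_form C a b) x = 0.
  rewrite (@near_eq_derive _ _ _ _ (cst (canonical_form a b))) ?derive_cst//.
  near=> y; have Cy : ccod C y.
    by near: y; exact: (open_near (@ccod_open _ _ _ C) Cx).
  exact: local_canonical_form.
by rewrite (D0 v w u) (D0 w u v) (D0 u v w) !addr0.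
Unshelve. all: by end_near. Qed.

End canonical_two_form.

(** * The Hamiltonian field and the zero section *)

Lemma Ck_on_dot (R : realType) n m k (U : set 'rV[R]_n)
    (f g : 'rV[R]_n -> 'rV[R]_m) : open U ->
  Ck_on k U f -> Ck_on k U g -> Ck_on k U (fun x => dot (f x) (g x)).
Proof.
move=> oU cf cg; apply: Ck_on_sum => // j; apply: Ck_onM => //.
  exact: ((Ck_on_coordP _ _ oU).2 cf j).
exact: ((Ck_on_coordP _ _ oU).2 cg j).
Qed.

Lemma canonical_sharp_smooth (R : realType) m (U : set 'rV[R]_(m + m))
    (f : 'rV[R]_(m + m) -> R) : open U -> smooth_on U f ->
  smooth_on U (fun z => canonical_sharp ('d f z)).
Proof.
move=> oU sf k.
have cD v : Ck_on k U (fun z => 'd f z v : R).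
  have [df /(_ v) Df] := sf k.+1.
  by apply: Ck_on_ext Df => // z Uz; rewrite deriveE//; exact: df.
apply: Ck_on_row_mx => //; apply: (Ck_on_coordP _ _ oU).1 => j.
  by apply: Ck_on_ext (cD (row_mx 0 (delta_mx 0 j))) => // z _; rewrite mxE.
apply: Ck_on_ext (Ck_onM oU (Ck_on_cst k U (-1 : R))
  (cD (row_mx (delta_mx 0 j) 0))) => // z _.
by rewrite !mxE mulN1r.
Qed.

Section hamiltonian.
Variables (R : realType) (m : nat) (M : manifold R m) (X : vector_field M).
Local Notation N := (cotangent_bundle M).

(** The Hamiltonian. Both factors are coordinates in [chart_at P.1]. *)
Definition momentum (P : N) : R := dot (X P.1 : 'rV[R]_m) P.2.

(** The matrices changing the coordinates of vectors and of covectors are adjoint for [dot], so the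
    pairing has the same expression in every lifted chart, where both factors are smooth. *)
Lemma momentum_lift c z : atlas c -> lift_cod c z ->
  momentum (lift_inv c z) = dot (dchart c (X (cinv c (lsubmx z)))) (rsubmx z).
Proof. by move=> ac cz; rewrite dchartE dot_mulmx. Qed.

Lemma momentum_smooth : smooth_fun momentum.
Proof.
move=> C [c [ac ->]] k /=; have o := open_lift_cod c.
apply: (@Ck_on_ext _ _ _ _ _
  (fun z => dot (dchart c (X (cinv c (lsubmx z)))) (rsubmx z))) => //.
  by move=> z cz; rewrite /= momentum_lift.
apply: Ck_on_dot => //; last by apply: Ck_on_linear; exact: continuous_rsubmx.
apply: (@Ck_on_comp _ _ _ _ _ _ (ccod c) lsubmx
  (fun x => dchart c (X (cinv c x)))) => //.
- exact: ccod_open.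
- by apply: Ck_on_linear; exact: continuous_lsubmx.
- exact: vf_smooth.
Qed.

Definition hamiltonian_vector (P : N) : tangent_space P :=
  canonical_sharp ('d (momentum \o cinv (chart_at P)) (cmap (chart_at P) P)).

(** Both sides have the same pairing with every [w], since the Jacobians preserve the form while the
    differential of [momentum] follows the chain rule. In the fixed chart [C] the field becomes
    visibly smooth. *)
Lemma hamiltonian_vector_chart (C : chart R N (m + m)) z : atlas C -> ccod C z ->
  dchart C (hamiltonian_vector (cinv C z)) =
  canonical_sharp ('d (momentum \o cinv C) z).
Proof.
move=> [c [ac EC]]; subst C => cz.
pose C : chart R N (m + m) := lift_chart ac; rewrite -/C in cz *.
set P : N := cinv C z; set E := chart_at P.
have aC : @atlas R _ N C by exists c, ac.
have aE : @atlas R _ N E by exact: chart_at_atlas.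
have CP : cdom C P by exact: cinv_fun.
have EP : cdom E P by exact: chart_at_dom.
apply: canonical_form_inj => w.
rewrite canonical_sharpP dchartE.
have dH : differentiable (momentum \o cinv E) (cmap E P).
  by have [dH _] := momentum_smooth aE 1; apply: dH; exact: cmap_fun.
(* Writing [w] this way gives both arguments of the form the same factor [jac E C P], which can then
   be removed. *)
have W : w = w *m jac C E P *m jac E C P.
  by rewrite -mulmxA jacM// jac_id// mulmx1.
have zE : z = cmap C P by rewrite /P cinvK.
rewrite [in LHS]W jac_lift_symplectic; [|exact: EP|exact: CP].
rewrite canonical_sharpP [in RHS]zE.
exact: (esym (diff_change_chart aC aE CP EP dH w)).
Qed.

Lemma hamiltonian_vector_smooth C : atlas C ->
  smooth_on (ccod C) (fun x => dchart C (hamiltonian_vector (cinv C x))).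
Proof.
move=> aC k; apply: Ck_on_ext (canonical_sharp_smooth _ (momentum_smooth aC) k).
- exact: ccod_open.
- by move=> z Cz; rewrite hamiltonian_vector_chart.
- exact: ccod_open.
Qed.

Definition hamiltonian_field : vector_field N :=
  VectorField hamiltonian_vector_smooth.

Lemma hamiltonian_fieldP :
  is_hamiltonian_field (canonical_two_form M) momentum hamiltonian_field.
Proof. by move=> P v; exact: canonical_sharpP. Qed.

Definition zero_section (p : M) : N := (p, 0).

(** The zero covector has zero coordinates in every chart, so [chart_at] drops out. *)
Lemma lift_map_zero c p : lift_map c (zero_section p) = row_mx (cmap c p) 0.
Proof. by rewrite /lift_map /= mul0mx. Qed.

Lemma Ck_row_mx0 k : Ck_on k setT (fun x : 'rV[R]_m => row_mx x (0 : 'rV[R]_m)).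
Proof.
apply: Ck_on_row_mx; [exact: openT| |exact: Ck_on_cst].
by apply: (@Ck_on_linear _ _ _ _ _ idfun) => x.
Qed.

Lemma zero_section_continuous : continuous zero_section.
Proof.
apply/continuousP => W oW; rewrite openE => p Wp.
pose c := chart_at p; have ac : atlas c := chart_at_atlas p.
have o : open (cdom c `&` (fun q => row_mx (cmap c q) (0 : 'rV[R]_m)) @^-1`
    (lift_cod c `&` lift_inv c @^-1` W)).
  apply: open_setI_preimage; [exact: cdom_open| |exact: (oW c ac)].
  move=> q cq; apply: (@continuous_comp _ _ _ (cmap c)
    (fun x => row_mx x (0 : 'rV[R]_m))); first exact: cmap_continuous.
  exact: (Ck_row_mx0 0 _ I).
have inv0 q : cdom c q -> lift_inv c (row_mx (cmap c q) 0) = zero_section q.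
  by move=> cq; rewrite -lift_map_zero lift_mapK.
have cp : cdom c p := chart_at_dom p.
have pW : (cdom c `&` (fun q => row_mx (cmap c q) (0 : 'rV[R]_m)) @^-1`
    (lift_cod c `&` lift_inv c @^-1` W)) p.
  split=> //; split; last by rewrite /= inv0.
  by rewrite /lift_cod /= row_mxKl; exact: cmap_fun.
apply: filterS (open_nbhs_nbhs (conj o pW)).
by move=> q [cq [_]] /=; rewrite inv0.
Qed.

Lemma zero_section_smooth : smooth_map zero_section.
Proof.
split; first exact: zero_section_continuous.
move=> c D ac [d [ad ->]] k /=.
apply: Ck_on_ext (Ck_on_row_mx (open_overlap c d) (atlas_compatible ac ad k)
  (Ck_on_cst k _ 0)).
- exact: open_overlap.
- by move=> x _; rewrite /= lift_map_zero.
Qed.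

(** The distinguished chart at [zero_section p] is the lift of [chart_at p], so in the coordinates
    defining the two tangent spaces the section is, near the point, the linear map x -> (x, 0). *)
Lemma differential_zero_section p (v : tangent_space p) :
  differential zero_section v = row_mx (v : 'rV[R]_m) 0 :> 'rV[R]_(m + m).
Proof.
have rlin : linear (fun x : 'rV[R]_m => row_mx x (0 : 'rV[R]_m)).
  by move=> a x y; rewrite scale_row_mx add_row_mx scaler0 addr0.
pose rM := GRing.isLinear.Build _ _ _ _ _ rlin.
pose r : {linear 'rV[R]_m -> 'rV[R]_(m + m)} :=
  HB.pack (fun x : 'rV[R]_m => row_mx x (0 : 'rV[R]_m)) rM.
have cr : continuous r by move=> x; exact: (Ck_row_mx0 0 _ I).
set c := chart_at p; have cp : cdom c p := chart_at_dom p.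
have dr : differentiable r (cmap c p) by exact: linear_differentiable.
have nr : \forall x \near cmap c p, r x = (lift_map c \o zero_section \o cinv c) x.
  near=> x; have cx : ccod c x.
    by near: x; exact: (open_near (@ccod_open _ _ _ c) (cmap_fun cp)).
  by rewrite [in RHS]/= lift_map_zero cinvK.
have [_ H] := near_eq_diff nr dr.
refine (etrans (congr1 (fun L => L v) H) _).
by rewrite diff_lin.
Unshelve. all: by end_near. Qed.

Lemma zero_section_embedding : embedding zero_section.
Proof.
split.
- exact: zero_section_smooth.
- move=> p u v; rewrite !differential_zero_section => E.
  by have := congr1 lsubmx E; rewrite !row_mxKl.
- by move=> p q [].
(* The bundle projection is a continuous left inverse of the section. *)
- move=> U oU; exists [set P : N | U P.1] => //.
  exact: cotangent_fst_open.
Qed.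

(** In the Leibniz rule, the derivative of [X] is paired with the momentum, which vanishes here;
    only [X] itself, paired with the vertical part of [w], survives. *)
Lemma derive_momentum_zero c p w : atlas c -> cdom c p ->
  'd (momentum \o lift_inv c) (row_mx (cmap c p) 0) w =
  dot (dchart c (X p)) (rsubmx w).
Proof.
move=> ac cp; pose z : 'rV[R]_(m + m) := row_mx (cmap c p) 0.
have cz : lift_cod c z by rewrite /lift_cod /= row_mxKl; exact: cmap_fun.
pose Xc x := dchart c (X (cinv c x)).
have dXc : differentiable Xc (lsubmx z).
  by have [dX _] := vf_smooth X ac 1; exact: dX.
have aC : @atlas R _ N (lift_chart ac) by exists c, ac.
have dH : differentiable (momentum \o lift_inv c) z.
  by have [dH _] := momentum_smooth aC 1; exact: dH.
refine (etrans (esym (deriveE w dH)) _).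
have nH : \forall y \near z, (momentum \o lift_inv c) y =
    dot ((Xc \o lsubmx) y) (rsubmx y).
  near=> y; rewrite /= momentum_lift//.
  by near: y; exact: (open_near (open_lift_cod c) cz).
refine (etrans (near_eq_derive w nH) _).
refine (etrans (derive_dot w (differentiable_comp (differentiable_lsubmx z) dXc)
  (differentiable_rsubmx z)) _).
have -> : 'D_w (rsubmx : _ -> 'rV[R]_m) z = rsubmx w.
  rewrite deriveE; last exact: differentiable_rsubmx.
  by rewrite diff_lin//; exact: continuous_rsubmx.
rewrite [rsubmx z]row_mxKr dot0r add0r /= row_mxKl /Xc.
by rewrite cmapK.
Unshelve. all: by end_near. Qed.

Lemma hamiltonian_field_zero_section p :
  differential zero_section (X p) = hamiltonian_field (zero_section p).
Proof.
set c := chart_at p; have cp : cdom c p := chart_at_dom p.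
have Xp : dchart c (X p) = X p by rewrite dchartE jac_id// mulmx1.
rewrite differential_zero_section.
apply: canonical_form_inj => w; rewrite [RHS]canonical_sharpP.
rewrite [X in 'd _ X]lift_map_zero.
refine (etrans _ (esym (derive_momentum_zero w (chart_at_atlas p) cp))).
by rewrite Xp /canonical_form row_mxKl row_mxKr dot0r subr0.
Qed.
End hamiltonian.

Theorem proposition2p3 (R : realType) :
  universal_for (hamiltonian_systems R) (smooth_vector_fields R).
Proof.
move=> m M X _; exists (m + m)%N, (cotangent_bundle M), (hamiltonian_field X).
split.
  exists (canonical_two_form M), (momentum X); split.
  - exact: canonical_symplectic.
  - exact: momentum_smooth.
  - exact: hamiltonian_fieldP.
exists (@zero_section R m M); split; first exact: zero_section_embedding.
exact: hamiltonian_field_zero_section.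
Qed.
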